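(* Let $n\geq1$ be an integer. Let $X$ be a normal space of covering dimension at most $3$. Let $f:X\to M_n^{\mathrm{sa}}$ and $\epsilon:X\to\mathbb{R}_{>0}$ be continuous. Then there exist continuous maps $g:X\to M_n^{\mathrm{sa}}$ and $u:X\to U_n$ such that $\|u(x)f(x)u(x)^*-g(x)\|<\epsilon(x)$ for all $x\in X$, and there exists an open subset $U$ of $X$ such that: (1) for all $x\in U$, $g(x)$ has $n$ distinct eigenvalues; (2) for all $x\in X\setminus U$, $g(x)$ has the block-diagonal form $$g(x)=\begin{pmatrix}g'(x)&0\\0&\lambda(x)\end{pmatrix}$$ where $g'(x)$ is an $(n-1)\times(n-1)$ matrix which has $n-1$ distinct eigenvalues, and $\lambda(x)\in\mathbb{R}$.
   Context: $M_n^{\mathrm{sa}}$ is the set of self-adjoint complex $n\times n$ matrices (with the operator norm), $U_n$ the set of unitary $n\times n$ matrices. A topological space is normal if any two disjoint closed subsets have disjoint neighborhoods (no Hausdorff assumption). Covering dimension: a space $X$ has dimension at most $d$ if every open covering of $X$ has an open refinement $(V_j)_{j\in J}$ such that each $x\in X$ lies in $V_j$ for at most $d+1$ indices $j$. *)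

(* Defs.v *)
From HB Require Import structures.
From mathcomp Require Import all_boot all_order all_algebra.
From mathcomp Require Import all_classical all_reals all_analysis.
From mathcomp Require Import complex.

Set Implicit Arguments.
Unset Strict Implicit.
Unset Printing Implicit Defensive.

Import Order.TTheory GRing.Theory Num.Theory.
Import numFieldNormedType.Exports.

Local Open Scope classical_set_scope.
Local Open Scope card_scope.
Local Open Scope ring_scope.

(* The usual topology of the complex numbers, given by the modulus.  Matrices
   over R[i] then carry the library topology of entrywise convergence, which
   is that of the operator norm because the dimension is finite. *)
HB.instance Definition _ (R : realType) :=
  NormedModule.copy R[i] ((R[i] : numClosedFieldType)^o).

(* Normality of X is the library's [normal_space]; [normal_openP] identifies it
   with the separation of disjoint closed sets by disjoint open ones.  It does
   not include any Hausdorff or T1 axiom. *)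

(* A covering is an indexed family, and the multiplicity of a refinement counts
   indices, not distinct members. *)
Definition covering_dim_le (d : nat) (X : topologicalType) : Prop :=
  forall (I : Type) (W : I -> set X),
    (forall i, open (W i)) -> \bigcup_i W i = setT ->
    exists (J : Type) (V : J -> set X),
      [/\ forall j, open (V j),
          \bigcup_j V j = setT,
          forall j, exists i, V j `<=` W i
        & forall x, [set j | V j x] #<= `I_d.+1].

Section OperatorNorm.
Context {R : realType}.

Definition l2norm n (v : 'cV[R[i]]_n) : R :=
  Num.sqrt (\sum_i ComplexField.Normc.normc (v i 0) ^+ 2).

Definition opnorm m n (A : 'M[R[i]]_(m, n)) : R :=
  sup [set l2norm (A *m v) | v in [set v : 'cV[R[i]]_n | l2norm v <= 1]].

End OperatorNorm.

Definition has_distinct_eigenvalues (F : fieldType) (n : nat) (A : 'M[F]_n)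
    : Prop :=
  [set a : F | eigenvalue A a] #= `I_n.

(* Main.v *)
(* The theorem follows from a Householder tridiagonalization carried out
   continuously over X.  Write f as the block matrix with first column (c, b)
   and lower right block f0.  Since dim X <= 3, the map (b_0, b_1) : X -> C^2 = R^4
   can be perturbed so as to avoid 0.  A nowhere vanishing pair is rotated
   continuously to (r, 0) with r > 0, because S^3 = SU(2), and then a Householder
   reflection moves the whole column to a nonzero multiple of the first basis
   vector.  Conjugating f0 accordingly and iterating, f becomes, up to a small
   perturbation and a unitary conjugation, a tridiagonal g whose subdiagonal
   entries never vanish, except perhaps the last one.  A Hermitian tridiagonal
   matrix with nonzero subdiagonal has simple spectrum, so U can be taken to be
   the set where the last subdiagonal entry of g is nonzero; off U, g splits off
   its last diagonal entry. *)
Require Import Defs.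
From mathcomp Require Import all_boot all_order all_algebra.
From mathcomp Require Import all_classical all_reals all_analysis.
From mathcomp Require Import complex.
From mathcomp Require Import ring lra.

Import Order.TTheory GRing.Theory Num.Theory.
Import numFieldNormedType.Exports.

Local Open Scope classical_set_scope.
Local Open Scope sesquilinear_scope.
Local Open Scope complex_scope.
Local Open Scope ring_scope.

(** * Maps to Euclidean space over a finite-dimensional normal space *)

Lemma continuous_bigmax (R : realType) (X : topologicalType) (I : Type)
    (r : seq I) (P : pred I) (F : I -> X -> R) :
  (forall i, continuous (F i)) ->
  continuous (fun x => \big[Num.max/0]_(i <- r | P i) F i x).
Proof.
move=> cF; elim: r => [|i r IH].
  by under eq_fun do rewrite big_nil; exact: cst_continuous.
under eq_fun do rewrite big_cons.
case: (P i) => // x.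
by apply: continuous_max; [exact: cF|exact: IH].
Qed.

(** Induction on [s]: a Urysohn function [f] for the head [a] is [1] on the part of [K] that the
    other sets miss, so the closed set of points of [K] with [f <= 2^-1] is covered by the tail. *)
Lemma finite_cover_functions (R : realType) (X : topologicalType) (I : eqType)
    (V : I -> set X) (s : seq I) (K : set X) :
  normal_space X -> (forall i, open (V i)) -> closed K ->
  K `<=` [set x | exists2 i, i \in s & V i x] ->
  exists phi : I -> X -> R,
    [/\ forall i, continuous (phi i),
        forall i x, 0 <= phi i x <= 1,
        forall i x, ~ V i x -> phi i x = 0
      & forall x, K x -> exists2 i, i \in s & 2^-1 <= phi i x].
Proof.
move=> nX oV; elim: s K => [|a s IH] K cK Ks.
  exists (fun _ _ => 0); split=> //.
  - by move=> i; exact: cst_continuous.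
  - by move=> i x; rewrite lexx ler01.
  - by move=> x /Ks[].
pose W := [set x | exists2 i, i \in s & V i x].
have oW : open W.
  have -> : W = \bigcup_(i in [set` s]) V i.
    by apply/seteqP; split=> x [i si Vi]; exists i.
  by apply: bigcup_open => i _; exact: oV.
have disj : ~` V a `&` (K `\` W) = set0.
  apply/seteqP; split=> // x [nVa [Kx nW]].
  have [i ] := Ks _ Kx; rewrite inE => /orP[/eqP->//|si Vi].
  by apply: nW; exists i.
have cKW : closed (K `\` W).
  by rewrite setDE; apply: closedI => //; exact: open_closedC.
move/(@normal_separatorP R X) : (nX) => sepV.
have /(@uniform_separatorP X R)[f [cf f01 f0 f1]] :=
  sepV _ _ (open_closedC (oV a)) cKW disj.
have cK' : closed (K `&` [set x | f x <= 2^-1]).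
  apply: closedI => //; apply: (@preimage_closed _ _ f [set y | y <= 2^-1]).
    by move=> x _; exact: cf.
  exact: closed_le.
have [x [Kx fx]|phi [cphi phi01 phi0 phi1]] := IH _ cK'.
  apply: contrapT => nWx.
  have /f1 : (f @` (K `\` W)) (f x) by exists x.
  by rewrite /= => fx1; move: fx; rewrite /= fx1; lra.
have fran x : 0 <= f x <= 1.
  have /f01 : range f (f x) by exists x.
  by rewrite /= in_itv.
(* The maximum covers the case where [a] occurs again in [s]. *)
exists (fun i => if i == a then fun x => Num.max (f x) (phi i x) else phi i); split.
- move=> i; case: eqP => // _ x.
  by apply: continuous_max; [exact: cf|exact: cphi].
- move=> i x; case: eqP => // _.
  have := fran x; have := phi01 i x.
  by rewrite le_max ge_max => /andP[-> ->] /andP[-> ->].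
- move=> i x nV; case: eqP => [ia|_]; last exact: phi0.
  rewrite phi0//.
  have /f0 -> : (f @` (~` V a)) (f x) by exists x => //; rewrite -ia.
  by rewrite maxxx.
- move=> x Kx; have [fx|fx] := leP (f x) 2^-1.
    have [i si phii] := phi1 x (conj Kx fx).
    exists i; first by rewrite inE si orbT.
    by case: eqP => // _; rewrite le_max phii orbT.
  by exists a; rewrite ?inE eqxx// le_max (ltW fx).
Qed.

(** The sign patterns of [h] give a finite open cover. A refinement of multiplicity at most [d.+1]
    yields functions [phi s] of which at most [d.+1] are nonzero at a point. From them a nowhere
    vanishing [k] is built that has the sign of [h] wherever [h] is not small, so [k] can replace
    [h] near its zeros. *)
Lemma nonvanishing_approximation (R : realType) (X : topologicalType) (d : nat)
    (h : 'I_d.+1 -> X -> R) (eps : X -> R) :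
  normal_space X -> covering_dim_le d X ->
  (forall i, continuous (h i)) ->
  (forall x, 0 < eps x) -> continuous eps ->
  exists h' : 'I_d.+1 -> X -> R,
    [/\ forall i, continuous (h' i),
        forall i x, `|h' i x - h i x| < eps x
      & forall x, exists i, h' i x != 0].
Proof.
move=> nX dX ch eps0 ceps.
(* Truncating [h] and adding [eta * k] each cost at most [eta]; the third share makes the bound
   strict. *)
pose eta x := eps x / 3.
have eta0 x : 0 < eta x by rewrite divr_gt0.
have ceta : continuous eta.
  by move=> x; apply: cvgM; [exact: ceps|exact: cvg_cst].
pose S := {ffun 'I_d.+1 -> bool}.
pose W (s : S) :=
  [set x | forall i, if s i then - eta x < h i x else h i x < eta x].
have oW s : open (W s).
  rewrite openE => x Wx; apply: filter_forall => i.
  have := Wx i; case: (s i) => hx.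
    have c1 : continuous (fun x => h i x - - eta x).
      by move=> y; apply: cvgB; [exact: ch|apply: cvgN; exact: ceta].
    apply: filterS (cvgr_gt _ (c1 x) 0 _) => [y /=|/=]; rewrite subr_gt0//.
  have c1 : continuous (fun x => eta x - h i x).
    by move=> y; apply: cvgB; [exact: ceta|exact: ch].
  apply: filterS (cvgr_gt _ (c1 x) 0 _) => [y /=|/=]; rewrite subr_gt0//.
have covW : \bigcup_s W s = setT.
  apply/seteqP; split=> // x _.
  exists [ffun i => 0 < h i x] => // i; rewrite ffunE.
  by have := eta0 x; case: (ltP 0 (h i x)); lra.
have [J [V [oV covV VW ordV]]] := dX _ W oW covW.
have [c cP] := choice VW.
(* Grouping by [c] makes the cover finite. Still [V' s] lies in [W s], and a point in [V' s] for
   distinct [s] lies in [V j] for distinct [j]. *)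
pose V' s := \bigcup_(j in [set j | c j = s]) V j.
have [|||phi [cphi phi01 phi0 phi1]] :=
  @finite_cover_functions R X S V' (enum S) setT nX.
- by move=> s; apply: bigcup_open => j _; exact: oV.
- exact: closedT.
- move=> x _; have : setT x by [].
  rewrite -covV => -[j _ Vj]; exists (c j); first by rewrite mem_enum.
  by exists j.
pose t (i : nat) : R := i.+3%:R^-1.
have t0 i : 0 < t i by rewrite invr_gt0.
have t1 i : t i < 2^-1 by rewrite ltf_pV2 ?posrE// ltr_nat.
pose m i x := \big[Num.max/0]_(s : S | s i) phi s x.
have m01 i x : 0 <= m i x <= 1.
  apply/andP; split; first exact: bigmax_ge_id.
  by apply: bigmax_le => // s _; have /andP[] := phi01 s x.
(* A nonzero value cannot be the default [0] of the maximum. *)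
have m_attained i x : m i x != 0 -> exists s : S, phi s x = m i x.
  rewrite /m; elim/big_ind : _ => [|y z IHy IHz|s _ _]; first by rewrite eqxx.
    by rewrite /Num.max; case: ifP => _ /=; [exact: IHz|exact: IHy].
  by exists s.
(* At a zero of k i some phi s equals t i.  The t i are distinct and below 1/2,
   and some phi s is at least 1/2, so a common zero of k 0, .., k d would lie in
   V j for d + 2 different j. *)
pose k i x := m i x - t i.
have k_nonvanishing x : exists i, k i x != 0.
  apply: contrapT => /forallNP k0.
  have mt i : m i x = t i.
    by apply/eqP; rewrite -subr_eq0; apply: contrapT => /negP; exact: k0.
  have phi_j s : phi s x != 0 -> exists j, V j x /\ c j = s.
    move=> /eqP phin0; apply: contrapT => nj; apply: phin0; apply: phi0.
    by case=> j /= cj Vj; apply: nj; exists j.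
  have [s0 _ s0P] := phi1 x I.
  pose v (i : 'I_d.+2) : R := if (i < d.+1)%N then t i else phi s0 x.
  have v_phi i : exists j, V j x /\ phi (c j) x = v i.
    rewrite /v; case: ifP => [ilt|_].
      have mn0 : m (Ordinal ilt) x != 0 by rewrite mt gt_eqF.
      have [s sE] := m_attained _ _ mn0.
      have [j [Vj cj]] : exists j, V j x /\ c j = s.
        by apply: phi_j; rewrite sE.
      by exists j; split=> //; rewrite cj sE mt.
    have [j [Vj cj]] : exists j, V j x /\ c j = s0.
      by apply: phi_j; rewrite gt_eqF//; apply: lt_le_trans s0P; rewrite invr_gt0.
    by exists j; rewrite cj.
  have v_inj : injective v.
    move=> i i'; rewrite /v; case: ifPn => hi; case: ifPn => hi'.
    - by move=> /invr_inj/eqP; rewrite eqr_nat => /eqP[] /val_inj.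
    - by move=> E; have := t1 i; rewrite E ltNge s0P.
    - by move=> E; have := t1 i'; rewrite -E ltNge s0P.
    - move=> _; apply: val_inj => /=.
      have := ltn_ord i; have := ltn_ord i'; move: hi hi'.
      by rewrite -!leqNgt !ltnS => l1 l2 l3 l4; apply/eqP; rewrite eqn_leq
        (leq_trans l4 l2) (leq_trans l3 l1).
  have [j jP] := choice v_phi.
  have /pcard_leP/unsquash F := ordV x.
  have Flt i : (F (j i) < d.+1)%N.
    by have := @funS _ _ _ _ F (j i); apply; have [] := jP i.
  have Finj : injective (fun i => Ordinal (Flt i)).
    move=> i i' /(congr1 val)/= FE; apply: v_inj.
    have [Vi <-] := jP i; have [Vi' <-] := jP i'.
    by congr (phi (c _) x); apply: (@inj _ _ _ F) => //; rewrite inE.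
  by have := leq_card _ Finj; rewrite !card_ord ltnn.
have ck i : continuous (k i).
  move=> x; apply: cvgB; last exact: cvg_cst.
  by apply: continuous_bigmax; exact: cphi.
(* h' i and k i have the same zeros: k i has the sign of h i where
   |h i| >= eta, and h' i = eta * k i elsewhere. *)
pose h' i x :=
  Num.max (h i x - eta x) 0 + Num.min (h i x + eta x) 0 + eta x * k i x.
(* Here [x] is in no [W s] with [s i] false, so the pattern with [phi s x >= 2^-1] counts in
   [m i]. *)
have kA i x : eta x <= h i x -> 0 < k i x.
  move=> hx; have [s _ phis] := phi1 x I.
  have si : s i.
    apply: contrapT => /negP/negPf si.
    have [j /= cj Vj] : V' s x.
      apply: contrapT => /phi0 E; move: phis; rewrite E.
      by rewrite leNgt invr_gt0 ltr0n.
    by have := cP j x Vj i; rewrite cj si; lra.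
  rewrite subr_gt0; apply: lt_le_trans (t1 i) _; apply: le_trans phis _.
  by apply: (le_bigmax_cond _ (fun s => phi s x)).
(* Here [x] is in no [W s] with [s i] true, so [m i] vanishes and [k i] equals [- t i]. *)
have kB i x : h i x <= - eta x -> k i x < 0.
  move=> hx; rewrite subr_lt0.
  suff -> : m i x = 0 by exact: t0.
  apply: big1_idem => //=; first by rewrite maxxx.
  move=> s si; apply: phi0 => -[j /= cj Vj].
  by have := cP j x Vj i; rewrite cj si; lra.
exists h'; split.
- move=> i x; apply: cvgD; last by apply: cvgM; [exact: ceta|exact: ck].
  apply: cvgD.
    apply: (@continuous_max _ _ (fun x => h i x - eta x) (fun=> 0));
      last exact: cst_continuous.
    by apply: cvgB; [exact: ch|exact: ceta].
  apply: (@continuous_min _ _ (fun x => h i x + eta x) (fun=> 0));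
    last exact: cst_continuous.
  by apply: cvgD; [exact: ch|exact: ceta].
- move=> i x; have e0 := eta0 x.
  have epsE : eps x = 3 * eta x by rewrite /eta; field.
  have : `|eta x * k i x| <= eta x.
    rewrite normrM (gtr0_norm e0) ler_piMr ?(ltW e0)// ler_norml.
    have := m01 i x; have := t0 i; have := t1 i; rewrite /k; lra.
  rewrite epsE /h' ler_norml ltr_norml.
  by case: (leP (h i x - eta x) 0); case: (leP (h i x + eta x) 0); lra.
- move=> x; have [i ki] := k_nonvanishing x; exists i.
  have e0 := eta0 x; rewrite /h'.
  have [hA|hA] := leP (eta x) (h i x).
    rewrite gt_eqF// ltr_wpDl ?mulr_gt0 ?kA//.
    by case: (leP (h i x - eta x) 0); case: (leP (h i x + eta x) 0); lra.
  have [hB|hB] := leP (h i x) (- eta x).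
    rewrite lt_eqF// -oppr_gt0 opprD ltr_wpDl//; last first.
      by rewrite -mulrN mulr_gt0// oppr_gt0 kB.
    by case: (leP (h i x - eta x) 0); case: (leP (h i x + eta x) 0); lra.
  rewrite max_r; last by rewrite subr_le0 ltW.
  rewrite min_r; last by rewrite -[leLHS](addNr (eta x)) lerD2r ltW.
  by rewrite !add0r mulf_neq0// gt_eqF.
Qed.

(** * Continuity of complex matrix-valued maps *)

Lemma continuous_mxP (X T : topologicalType) (m n : nat) (A : X -> 'M[T]_(m, n)) :
  continuous A <-> forall i j, continuous (fun x => A x i j).
Proof.
split=> [cA i j x B nB|cA x B [P nP PB]].
  apply: (cA x [set M | B (M i j)]).
  exists (fun i' j' => [set y | i' = i -> j' = j -> B y]) => [i' j'|M MP].
    have [[-> ->]|ij] := pselect (i' = i /\ j' = j).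
      by apply: filterS nB => y By _ _.
    by apply: filterS filterT => y _ ii jj; case: ij.
  exact: MP.
suff : nbhs x [set y | forall ij : 'I_m * 'I_n, P ij.1 ij.2 (A y ij.1 ij.2)].
  by apply: filterS => y Py; apply: PB => i j; exact: (Py (i, j)).
by apply: filter_forall => -[i j] /=; apply: cA; exact: nP.
Qed.

Lemma continuous_sum (X : topologicalType) (K : numFieldType) (I : Type)
    (r : seq I) (F : I -> X -> K) :
  (forall i, continuous (F i)) -> continuous (fun x => \sum_(i <- r) F i x).
Proof.
move=> cF; elim: r => [|i r IH].
  by under eq_fun do rewrite big_nil; exact: cst_continuous.
under eq_fun do rewrite big_cons.
by move=> x; apply: cvgD; [exact: cF|exact: IH].
Qed.

Lemma continuous_dist_le (R : realType) (X : topologicalType) (f : X -> R[i])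
    (g : X -> R[i]) :
  continuous f -> (forall x y, `|g x - g y| <= `|f x - f y|) -> continuous g.
Proof.
move=> cf gf x; apply/cvgrPdist_lt => e e0.
have /cvgrPdist_lt/(_ e e0) := cf x.
by apply: filterS => y; apply: le_lt_trans.
Qed.

Lemma continuous_conj (R : realType) (X : topologicalType) (f : X -> R[i]) :
  continuous f -> continuous (fun x => Num.conj (f x)).
Proof.
move=> cf; apply: (continuous_dist_le _ _ _ _ cf) => x y.
by rewrite -rmorphB norm_conjC.
Qed.

Lemma continuous_real_complex (R : realType) (X : topologicalType) (f : X -> R) :
  continuous f <-> continuous (fun x => (f x)%:C).
Proof.
split=> cf x; apply/cvgrPdist_lt => e e0.
  (* In the order of [R[i]] a positive element is real, so [e] is a radius in [R]. *)
  have eE : e = (complex.Re e)%:C by rewrite RRe_real// gtr0_real.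
  have e0' : 0 < complex.Re e by rewrite -ltcR -eE.
  have /cvgrPdist_lt/(_ _ e0') := cf x.
  apply: filterS => y; rewrite -rmorphB eE normc_def/=.
  by rewrite expr0n addr0 sqrtr_sqr ltcR.
have e0' : 0 < e%:C by rewrite ltcR.
have /cvgrPdist_lt/(_ _ e0') := cf x.
apply: filterS => y; rewrite -rmorphB normc_def/=.
by rewrite expr0n addr0 sqrtr_sqr ltcR.
Qed.

Lemma continuous_complexP (R : realType) (X : topologicalType) (f : X -> R[i]) :
  continuous f <-> continuous (fun x => complex.Re (f x)) /\
                   continuous (fun x => complex.Im (f x)).
Proof.
split=> [cf|[cRe cIm]].
  split; apply/continuous_real_complex; apply: (continuous_dist_le _ _ _ _ cf) => x y.
    by rewrite -rmorphB -raddfB !normc_def/= lecR ler_wsqrtr// expr0n addr0 lerDl sqr_ge0.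
  by rewrite -rmorphB -raddfB !normc_def/= lecR ler_wsqrtr// expr0n addr0 lerDr sqr_ge0.
have -> : f = fun x => (complex.Re (f x))%:C + 'i%C * (complex.Im (f x))%:C.
  by apply/funext => x; exact: complexE.
move=> x; apply: cvgD; first by move/continuous_real_complex : cRe; exact.
by apply: cvgM; [exact: cvg_cst|move/continuous_real_complex : cIm; exact].
Qed.

Lemma continuous_mulmx (R : realType) (X : topologicalType) (m n p : nat)
    (A : X -> 'M[R[i]]_(m, n)) (B : X -> 'M[R[i]]_(n, p)) :
  continuous A -> continuous B -> continuous (fun x => A x *m B x).
Proof.
move=> /continuous_mxP cA /continuous_mxP cB; apply/continuous_mxP => i j.
under eq_fun do rewrite mxE.
by apply: continuous_sum => k x; apply: cvgM; [exact: cA|exact: cB].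
Qed.

Lemma continuous_addmx (R : realType) (X : topologicalType) (m n : nat)
    (A B : X -> 'M[R[i]]_(m, n)) :
  continuous A -> continuous B -> continuous (fun x => A x + B x).
Proof.
move=> /continuous_mxP cA /continuous_mxP cB; apply/continuous_mxP => i j.
under eq_fun do rewrite mxE.
by move=> x; apply: cvgD; [exact: cA|exact: cB].
Qed.

Lemma continuous_scalemx (R : realType) (X : topologicalType) (m n : nat)
    (a : X -> R[i]) (A : X -> 'M[R[i]]_(m, n)) :
  continuous a -> continuous A -> continuous (fun x => a x *: A x).
Proof.
move=> ca /continuous_mxP cA; apply/continuous_mxP => i j.
under eq_fun do rewrite mxE.
by move=> x; apply: cvgM; [exact: ca|exact: cA].
Qed.

Lemma continuous_adjmx (R : realType) (X : topologicalType) (m n : nat)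
    (A : X -> 'M[R[i]]_(m, n)) :
  continuous A -> continuous (fun x => (A x)^t*).
Proof.
move=> /continuous_mxP cA; apply/continuous_mxP => i j.
under eq_fun do rewrite !mxE.
by apply: continuous_conj; exact: cA.
Qed.

Lemma continuous_block_mx (T X : topologicalType) (m1 m2 n1 n2 : nat)
    (A : X -> 'M[T]_(m1, n1)) (B : X -> 'M[T]_(m1, n2))
    (C : X -> 'M[T]_(m2, n1)) (D : X -> 'M[T]_(m2, n2)) :
  continuous A -> continuous B -> continuous C -> continuous D ->
  continuous (fun x => block_mx (A x) (B x) (C x) (D x)).
Proof.
move=> /continuous_mxP cA /continuous_mxP cB /continuous_mxP cC /continuous_mxP cD.
apply/continuous_mxP => i j.
case: (split_ordP i) => i' ->; case: (split_ordP j) => j' ->.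
- by under eq_fun do rewrite block_mxEul; exact: cA.
- by under eq_fun do rewrite block_mxEur; exact: cB.
- by under eq_fun do rewrite block_mxEdl; exact: cC.
- by under eq_fun do rewrite block_mxEdr; exact: cD.
Qed.

(** * Hermitian and unitary matrices *)

Lemma adjmx_mul (C : numClosedFieldType) (m n p : nat) (A : 'M[C]_(m, n))
    (B : 'M[C]_(n, p)) : (A *m B)^t* = B^t* *m A^t*.
Proof. by rewrite trmx_mul map_mxM. Qed.

Lemma hermsymmxP (C : numClosedFieldType) (n : nat) (A : 'M[C]_n) :
  A \is hermsymmx <-> A^t* = A.
Proof.
rewrite is_hermitianmxE expr0 scale1r.
by split=> [/eqP <-//|->].
Qed.

(** As [k] is half the squared length of [z], this is the reflection in the hyperplane orthogonal to
    [z]: it is self-adjoint and squares to the identity. *)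
Lemma householder_unitary (C : numClosedFieldType) (n : nat) (z : 'cV[C]_n) (k : C) :
  k != 0 -> k^* = k -> z^t* *m z = (k *+ 2)%:M ->
  1%:M - k^-1 *: (z *m z^t*) \is unitarymx.
Proof.
move=> k0 kr zz; apply/unitarymxP.
have -> : (1%:M - k^-1 *: (z *m z^t*))^t* = 1%:M - k^-1 *: (z *m z^t*).
  rewrite !linearB/= linearZ/= map_mxB map_mxZ trmx1 map_mx1 adjmx_mul trmxCK.
  by rewrite fmorphV/= kr.
rewrite mulmxBl mul1mx mulmxBr mulmx1 -scalemxAl -scalemxAr scalerA.
rewrite mulmxA -(mulmxA z) zz mul_mx_scalar -scalemxAl scalerA.
have -> : k^-1 * k^-1 * (k *+ 2) = k^-1 + k^-1 by field.
by rewrite scalerDl opprB addrK subrK.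
Qed.

Lemma block_diag_unitary (C : numClosedFieldType) (m n : nat) (A : 'M[C]_m) (B : 'M[C]_n) :
  A \is unitarymx -> B \is unitarymx -> block_mx A 0 0 B \is unitarymx.
Proof.
move=> /unitarymxP AA /unitarymxP BB; apply/unitarymxP.
rewrite tr_block_mx map_block_mx mulmx_block !trmx0 !map_mx0 AA BB.
by rewrite !mul0mx !mulmx0 !addr0 add0r -scalar_mx_block.
Qed.

Definition colnorm (R : realType) (n : nat) (v : 'cV[R[i]]_n) : R :=
  Num.sqrt (complex.Re ((v^t* *m v) 0 0)).

Arguments colnorm {R n} v.

Lemma colnorm_sqr (R : realType) (n : nat) (v : 'cV[R[i]]_n) :
  v^t* *m v = ((colnorm v)%:C ^+ 2)%:M.
Proof.
have vv : (v^t* *m v) 0 0 = \sum_i `|v i 0| ^+ 2.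
  rewrite mxE; apply: eq_bigr => i _.
  by rewrite !mxE mulrC -normCK.
have vv0 : 0 <= (v^t* *m v) 0 0.
  by rewrite vv; apply: sumr_ge0 => i _; rewrite exprn_ge0.
rewrite [LHS]mx11_scalar; congr (_ %:M).
rewrite -rmorphXn/= sqr_sqrtr ?RRe_real ?ger0_real//.
by rewrite -lecR RRe_real// ger0_real.
Qed.

Lemma colnorm_gt0 (R : realType) (n : nat) (v : 'cV[R[i]]_n) (i : 'I_n) :
  v i 0 != 0 -> 0 < colnorm v.
Proof.
move=> vi; rewrite lt_neqAle sqrtr_ge0 andbT eq_sym.
apply: contra vi => /eqP v0.
have := colnorm_sqr _ _ v; rewrite v0 expr0n/= => /matrixP/(_ 0 0).
rewrite !mxE mulr1n => /eqP; rewrite psumr_eq0 => [/allP/(_ i)|j _].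
  by rewrite mem_index_enum => /(_ isT); rewrite !mxE mulf_eq0 conjC_eq0 orbb.
by rewrite !mxE mulrC mul_conjC_ge0.
Qed.

Lemma continuous_colnorm (R : realType) (X : topologicalType) (n : nat)
    (v : X -> 'cV[R[i]]_n) :
  continuous v -> continuous (fun x => (colnorm (v x))%:C).
Proof.
move=> cv; apply/continuous_real_complex => x.
apply: (@continuous_comp _ _ _ (fun x => complex.Re (((v x)^t* *m v x) 0 0)) Num.sqrt);
  last exact: sqrt_continuous.
have /continuous_mxP/(_ 0 0)/continuous_complexP[cRe _] :=
  continuous_mulmx _ _ _ _ _ _ _ (continuous_adjmx _ _ _ _ _ cv) cv.
exact: cRe.
Qed.

(** Column [m] of [v *m A = a *: v] determines coordinate [m.+1] of [v] from the earlier ones,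
    because the subdiagonal entry multiplying it is invertible. *)
Lemma hessenberg_eigenvector_eq0 (F : fieldType) (n : nat) (A : 'M[F]_n)
    (v : 'rV[F]_n) (a : F) :
  (forall i j : 'I_n, (j.+1 < i)%N -> A i j = 0) ->
  (forall i j : 'I_n, i = j.+1 :> nat -> A i j != 0) ->
  v *m A = a *: v -> (forall i : 'I_n, i = 0%N :> nat -> v 0 i = 0) -> v = 0.
Proof.
move=> A0 An0 vA v0.
suff vm m (i : 'I_n) : (i <= m)%N -> v 0 i = 0.
  by apply/rowP => i; rewrite mxE (vm i).
elim: m i => [|m IH] i; first by rewrite leqn0 => /eqP; exact: v0.
rewrite leq_eqVlt => /orP[/eqP im|]; last exact: IH.
have mn : (m < n)%N by rewrite ltnW// -im.
have /rowP/(_ (Ordinal mn)) := vA.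
rewrite !mxE (IH (Ordinal mn))// mulr0 (bigD1 i)//= big1 ?addr0 => [/eqP|l li].
  by rewrite mulf_eq0 (negPf (An0 i (Ordinal mn) im)) orbF => /eqP.
have [lm|ml] := leqP l m; first by rewrite IH ?mul0r.
rewrite A0 ?mulr0//= ltn_neqAle ml andbT.
by apply: contra li => /eqP ml'; apply/eqP/val_inj; rewrite /= im.
Qed.

(** An eigenvector is determined by its first coordinate, so every eigenspace is a line; as [A] is
    diagonalizable, its [n] diagonal values are then distinct. *)
Lemma hessenberg_distinct_eigenvalues (C : numClosedFieldType) (n : nat) (A : 'M[C]_n) :
  A \is hermsymmx ->
  (forall i j : 'I_n, (j.+1 < i)%N -> A i j = 0) ->
  (forall i j : 'I_n, i = j.+1 :> nat -> A i j != 0) ->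
  has_distinct_eigenvalues A.
Proof.
move=> hA A0 An0.
have /hermitian_normalmx/orthomx_spectralP AE := hA.
set P := spectralmx A in AE; set d := spectral_diag A in AE.
have Pu : P \in unitmx by exact: spectral_unit.
have PA : P *m A = diag_mx d *m P by rewrite AE -mulmxA mulKVmx.
have rowE i : row i P *m A = d 0 i *: row i P.
  by rewrite -row_mul PA mul_diag_mx; apply/rowP => j; rewrite !mxE.
(* Two eigenvectors for the same eigenvalue have a nonzero combination whose
   first coordinate vanishes. *)
have dinj : injective (d 0).
  move=> i j dij; apply: contrapT => ij.
  have first0 (w : 'rV[C]_n) : w *m A = d 0 i *: w ->
      (forall k : 'I_n, k = 0%N :> nat -> w 0 k = 0) -> w = 0.
    exact: hessenberg_eigenvector_eq0.
  have n0 : (0 < n)%N by apply: leq_ltn_trans (ltn_ord i).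
  pose o := Ordinal n0.
  have oE (k : 'I_n) : k = 0%N :> nat -> k = o by move=> k0; apply: val_inj.
  have rown0 k : row k P != 0.
    apply/eqP => /(congr1 (mulmx^~ (invmx P))).
    rewrite -row_mul mulmxV// mul0mx => /rowP/(_ k).
    by rewrite !mxE eqxx => /eqP; rewrite oner_eq0.
  have Pio : P i o != 0.
    apply: contra (rown0 i) => /eqP Pio; apply/eqP/first0; first exact: rowE.
    by move=> k /oE ->; rewrite mxE.
  pose c : 'rV[C]_n := P j o *: delta_mx 0 i - P i o *: delta_mx 0 j.
  have cP : c *m P = 0.
    have cPE : c *m P = P j o *: row i P - P i o *: row j P.
      by rewrite mulmxBl -!scalemxAl -!matrix.rowE.
    apply: first0.
      by rewrite cPE mulmxBl -!scalemxAl !rowE dij scalerBr !scalerA ![d 0 j * _]mulrC.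
    by move=> k /oE ->; rewrite cPE !mxE mulrC subrr.
  (* Invertibility of [P] forces [c = 0], but the entry of [c] at [j] is [- P i o]. *)
  have : c 0 j = 0.
    by rewrite -[c](mulmxK Pu) cP mul0mx mxE.
  rewrite !mxE !eqxx/= (_ : (j == i) = false) ?mulr0 ?add0r ?mulr1; last first.
    by apply/eqP => ji; apply: ij.
  by move=> /eqP; rewrite oppr_eq0 (negPf Pio).
have eigE : [set a | eigenvalue A a] = d 0 @` [set: 'I_n].
  apply/seteqP; split=> a.
    move=> /eigenvalueP[v vA vn0].
    pose w := v *m invmx P.
    have wd : w *m diag_mx d = a *: w.
      by rewrite /w scalemxAl -vA AE !mulmxA mulmxK.
    have /rV0Pn[i wi] : w != 0.
      by apply: contra vn0 => /eqP w0; rewrite -[v](mulmxKV Pu) -/w w0 mul0mx.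
    exists i => //; apply: (mulfI wi).
    by have /rowP/(_ i) := wd; rewrite mul_mx_diag !mxE mulrC => ->; rewrite mulrC.
  move=> [i _ <-]; apply/eigenvalueP; exists (row i P); first exact: rowE.
  apply/eqP => /(congr1 (mulmx^~ (invmx P))).
  rewrite -row_mul mulmxV// mul0mx => /rowP/(_ i).
  by rewrite !mxE eqxx => /eqP; rewrite oner_eq0.
rewrite /has_distinct_eigenvalues eigE.
apply: card_eq_trans (inj_card_eq _) _; first by move=> i j _ _; exact: dinj.
by rewrite card_eq_sym; exact: card_II.
Qed.

(** Cauchy-Schwarz on each row bounds the operator norm by the Frobenius norm. Errors are measured
    in the latter because it adds up over blocks and is invariant under unitary conjugation. *)
Lemma opnorm_lt_frobenius (R : realType) (m n : nat) (A : 'M[R[i]]_(m, n)) (e : R) :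
  0 < e -> \tr (A *m A^t*) < (e ^+ 2)%:C -> opnorm A < e.
Proof.
move=> e0 Ae.
have l2E p (v : 'cV[R[i]]_p) :
    (\sum_i ComplexField.Normc.normc (v i 0) ^+ 2)%:C = \sum_i `|v i 0| ^+ 2.
  by rewrite rmorph_sum; apply: eq_bigr => i _; rewrite rmorphXn.
have l2s p (v : 'cV[R[i]]_p) : ((l2norm v) ^+ 2)%:C = \sum_i `|v i 0| ^+ 2.
  by rewrite sqr_sqrtr ?l2E//; apply: sumr_ge0 => i _; rewrite sqr_ge0.
have dotE p (v : 'cV[R[i]]_p) : dotmx (v^t*) (v^t*) = \sum_i `|v i 0| ^+ 2.
  rewrite dotmxE mxE; apply: eq_bigr => i _.
  by rewrite !mxE conjCK mulrC -normCK.
have F0 : 0 <= \tr (A *m A^t*).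
  apply: sumr_ge0 => i _; rewrite mxE; apply: sumr_ge0 => j _.
  by rewrite !mxE mul_conjC_ge0.
pose F := complex.Re (\tr (A *m A^t*)).
have FE : F%:C = \tr (A *m A^t*) by rewrite RRe_real// ger0_real.
have F0' : 0 <= F by rewrite -lecR FE.
(* A supremum inherits only a weak bound, so strictness is obtained at the Frobenius norm. *)
apply: (@le_lt_trans _ _ (Num.sqrt F)); last first.
  rewrite -(ltr_pXn2r (_ : 0 < 2)%N) ?nnegrE ?sqrtr_ge0 ?(ltW e0)//.
  by rewrite sqr_sqrtr// -ltcR FE.
apply: ge_sup.
  by exists (l2norm (A *m 0)); exists 0 => //=; rewrite /l2norm big1 ?sqrtr0//
    => i _; rewrite mxE ComplexField.Normc.normc0 expr0n.
move=> _ [v v1 <-].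
rewrite -(ler_pXn2r (_ : 0 < 2)%N) ?nnegrE ?sqrtr_ge0//.
rewrite -lecR [X in _ <= X%:C]sqr_sqrtr// l2s FE.
have v1' : dotmx (v^t*) (v^t*) <= 1.
  rewrite dotE -l2s -[1]/(1%:C) lecR -(expr1n _ 2) ler_pXn2r// nnegrE ?sqrtr_ge0//.
rewrite /mxtrace; apply: ler_sum => i _.
have -> : (A *m v) i 0 = dotmx (row i A) (v^t*).
  by rewrite dotmxE trmxCK -row_mul [RHS]mxE.
apply: le_trans (CauchySchwarz (@dotmx _ n) (row i A) (v^t*)).1 _.
have -> : (A *m A^t*) i i = dotmx (row i A) (row i A).
  by rewrite dotmxE !mxE; apply: eq_bigr => j _; rewrite !mxE.
by rewrite ler_piMr// dnorm_ge0.
Qed.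

(** Write rho for [colnorm b]. Then [z^t* *m b] is rho (rho + c), which is half of [z^t* *m z], so
    [H] sends [b] to [b - z]. Since [c > 0], the plus sign in [z] rules out cancellation. *)
Lemma householder_col (R : realType) (n : nat) (b : 'cV[R[i]]_n.+1) (c : R) :
  0 < c -> b 0 0 = c%:C ->
  let z := b + (colnorm b)%:C *: delta_mx 0 0 in
  let H := 1%:M - ((colnorm b * (colnorm b + c))%:C)^-1 *: (z *m z^t*) in
  H \is unitarymx /\ H *m b = - (colnorm b)%:C *: delta_mx 0 0.
Proof.
move=> c0 bc z H.
have rho0 : 0 < colnorm b.
  by apply: (@colnorm_gt0 _ _ _ 0);
    rewrite bc -[0]/(0%:C) (inj_eq (@complexI R)) gt_eqF.
set rho := colnorm b in z H rho0 *.
pose k : R[i] := (rho * (rho + c))%:C.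
have k0 : k != 0.
  by rewrite /k -[0]/(0%:C) (inj_eq (@complexI R)) mulf_neq0// gt_eqF// addr_gt0.
have realJ (a : R) : (Num.conj : {rmorphism R[i] -> R[i]}) a%:C = a%:C.
  exact: conjc_real.
pose e : 'cV[R[i]]_n.+1 := delta_mx 0 0.
have adj_e : e^t* = delta_mx 0 0 by rewrite trmx_delta map_delta_mx.
have eb : e^t* *m b = (c%:C)%:M.
  by rewrite adj_e -rowE [LHS]mx11_scalar mxE bc.
have be : b^t* *m e = (c%:C)%:M.
  by rewrite -[LHS]trmxCK adjmx_mul trmxCK eb tr_scalar_mx map_scalar_mx realJ.
have ee : e^t* *m e = 1%:M.
  by rewrite adj_e mul_delta_mx [LHS]mx11_scalar mxE.
have bb : b^t* *m b = ((rho%:C) ^+ 2)%:M by exact: colnorm_sqr.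
have zE : z^t* = b^t* + rho%:C *: e^t*.
  by rewrite linearD linearZ/= map_mxD map_mxZ realJ.
have zb : z^t* *m b = k%:M.
  rewrite zE mulmxDl -scalemxAl bb eb scale_scalar_mx -raddfD/=; congr (_%:M).
  by rewrite /k rmorphM rmorphD; ring.
have zz : z^t* *m z = (k *+ 2)%:M.
  rewrite {2}/z mulmxDr zb -scalemxAr zE mulmxDl be -scalemxAl ee.
  rewrite scale_scalar_mx -raddfD scale_scalar_mx -raddfD/=; congr (_%:M).
  by rewrite /k rmorphM rmorphD; ring.
split; first by apply: householder_unitary => //; exact: realJ.
rewrite mulmxBl mul1mx -scalemxAl -mulmxA zb mul_mx_scalar scalerA mulVf//.
by rewrite scale1r /z opprD addrA subrr add0r scaleNr.
Qed.

(** For [v != 0], the inverse of the element of SU(2) whose first column is [v] normalized, hence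
    continuous in [v] away from [0]. *)
Definition su2 (R : realType) (v : 'cV[R[i]]_2) : 'M[R[i]]_2 :=
  ((colnorm v)%:C)^-1 *:
  \matrix_(i, j) (if i == 0 then Num.conj (v j 0)
                  else if j == 0 then - v 1 0 else v 0 0).

Arguments su2 {R} v.

Lemma su2_rotation (R : realType) (v : 'cV[R[i]]_2) :
  v != 0 -> su2 v \is unitarymx /\ su2 v *m v = (colnorm v)%:C *: delta_mx 0 0.
Proof.
move=> v0.
have rho0 : 0 < colnorm v.
  have [i vi] : exists i, v i 0 != 0.
    apply/existsP; apply: contraR v0 => /existsPn v0.
    by apply/eqP/colP => i; rewrite mxE; apply/eqP; move: (v0 i); rewrite negbK.
  exact: (colnorm_gt0 _ _ _ _ vi).
have ord00 : ord0 = 0 :> 'I_2 by apply: val_inj.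
have ord2 (l : 'I_2) : l = 0 \/ l = 1.
  by case: l => [[|[|]]]// p; [left|right]; apply: val_inj.
have lift1 : lift ord0 ord0 = 1 :> 'I_2 by apply: val_inj.
have r0 : (colnorm v)%:C != 0.
  by rewrite -[0]/(0%:C) (inj_eq (@complexI R)) gt_eqF.
have vv : Num.conj (v 0 0) * v 0 0 + Num.conj (v 1 0) * v 1 0 = (colnorm v)%:C ^+ 2.
  have /matrixP/(_ 0 0) := colnorm_sqr _ _ v.
  by rewrite !mxE mulr1n big_ord_recl big_ord1 !mxE lift1 => <-.
have rJ : (Num.conj : {rmorphism R[i] -> R[i]}) (((colnorm v)%:C)^-1) =
    ((colnorm v)%:C)^-1.
  by rewrite fmorphV; congr (_^-1); exact: conjc_real.
split.
  apply/unitarymxP; rewrite /su2 linearZ/= map_mxZ rJ.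
  rewrite -scalemxAl -scalemxAr scalerA -invfM -expr2 -vv.
  have nz : Num.conj (v 0 0) * v 0 0 + Num.conj (v 1 0) * v 1 0 != 0.
    by rewrite vv expf_neq0.
  apply/matrixP => i j; rewrite !mxE !big_ord_recl big_ord0 !mxE/= addr0 lift1.
  case: (ord2 i) => ->; case: (ord2 j) => ->;
    rewrite !eqxx/= ?conjCK ?rmorphN/= ?ord00.
  - by field.
  - by ring.
  - by ring.
  - by field.
apply/colP => i; rewrite /su2 -scalemxAl !mxE !big_ord_recl big_ord0 !mxE/= addr0 lift1.
case: (ord2 i) => ->; rewrite !eqxx/= ?ord00.
  by rewrite vv mulr1 expr2 mulKf.
by rewrite mulr0; ring.
Qed.

(** [S] makes the leading entry positive, which fixes the phase that the Householder vector needs;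
    all denominators are then nonzero, and the composite is continuous. *)
Lemma unitary_rotation (R : realType) (X : topologicalType) (m : nat)
    (b : X -> 'cV[R[i]]_(2 + m)) :
  continuous b -> (forall x, usubmx (b x) != 0) ->
  exists (w : X -> 'M[R[i]]_(2 + m)) (r : X -> R[i]),
    [/\ continuous w, forall x, w x \is unitarymx, forall x, r x != 0
      & forall x, w x *m b x = r x *: delta_mx 0 0].
Proof.
move=> cb b0.
pose v x := usubmx (b x).
pose S x : 'M[R[i]]_(2 + m) := block_mx (su2 (v x)) 0 0 1%:M.
pose b1 x : 'cV[R[i]]_m.+2 := S x *m b x.
have v0 x : v x != 0 by exact: b0.
have rho0 x : 0 < colnorm (v x).
  have /cV0Pn[i vi] := v0 x.
  exact: (colnorm_gt0 _ _ _ _ vi).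
have b10 x : b1 x 0 0 = (colnorm (v x))%:C.
  have b1E : b1 x = col_mx (su2 (v x) *m v x) (dsubmx (b x)).
    by rewrite /b1 /S -{1}[b x]vsubmxK mul_block_col !mul0mx mul1mx addr0 add0r.
  transitivity (col_mx (su2 (v x) *m v x) (dsubmx (b x)) (lshift m 0) 0).
    by rewrite b1E; congr (fun_of_matrix _ _ _); exact: val_inj.
  rewrite col_mxEu.
  by rewrite (su2_rotation _ _ (v0 x)).2 !mxE mulr1.
have cv : continuous v.
  move/continuous_mxP : cb => cb; apply/continuous_mxP => i j.
  by under eq_fun do rewrite /v mxE; exact: cb.
have cS : continuous S.
  apply: continuous_block_mx; [|exact: cst_continuous..].
  apply: continuous_scalemx.
    move=> x; apply: cvgV; first by rewrite -[0]/(0%:C) (inj_eq (@complexI R)) gt_eqF.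
    exact: continuous_colnorm.
  have /continuous_mxP cv' := cv.
  apply/continuous_mxP => i j.
  under eq_fun do rewrite mxE.
  case: (i == 0); first exact: continuous_conj.
  case: (j == 0); last exact: cv'.
  by move=> x; apply: cvgN; exact: cv'.
have Su x : S x \is unitarymx.
  apply: block_diag_unitary; first exact: (su2_rotation _ _ (v0 x)).1.
  by apply/unitarymxP; rewrite mul1mx trmx1 map_mx1.
have cb1 : continuous b1 by exact: continuous_mulmx.
have b1n x : 0 < colnorm (b1 x).
  apply: (colnorm_gt0 _ _ _ 0).
  by rewrite b10 -[0]/(0%:C) (inj_eq (@complexI R)) gt_eqF.
pose z x := b1 x + (colnorm (b1 x))%:C *: delta_mx 0 0.
pose k x := (colnorm (b1 x) * (colnorm (b1 x) + colnorm (v x)))%:C.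
have hh x := householder_col _ _ _ _ (rho0 x) (b10 x).
exists (fun x => (1%:M - (k x)^-1 *: (z x *m (z x)^t*)) *m S x).
exists (fun x => - (colnorm (b1 x))%:C).
have cz : continuous z.
  apply: continuous_addmx; first exact: cb1.
  apply: continuous_scalemx; last exact: cst_continuous.
  exact: continuous_colnorm.
split.
- apply: continuous_mulmx; last exact: cS.
  apply: continuous_addmx; first exact: cst_continuous.
  under eq_fun do rewrite -scaleNr.
  apply: continuous_scalemx; last first.
    by apply: continuous_mulmx; [exact: cz|apply: continuous_adjmx; exact: cz].
  move=> x; apply: cvgN; apply: cvgV.
    by rewrite -[0]/(0%:C) (inj_eq (@complexI R)) gt_eqF// mulr_gt0// addr_gt0.
  rewrite /k; under eq_fun do rewrite rmorphM rmorphD.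
  rewrite rmorphM rmorphD.
  by apply: cvgM; [|apply: cvgD]; exact: continuous_colnorm.
- move=> x; apply: mul_unitarymx; first exact: (hh x).1.
  exact: Su.
- by move=> x; rewrite oppr_eq0 -[0]/(0%:C) (inj_eq (@complexI R)) gt_eqF.
- by move=> x; rewrite -mulmxA; exact: (hh x).2.
Qed.

(** * Continuous tridiagonalization *)

Lemma column_approximation (R : realType) (X : topologicalType) (m : nat)
    (b : X -> 'cV[R[i]]_(2 + m)) (delta : X -> R) :
  normal_space X -> covering_dim_le 3 X -> continuous b ->
  (forall x, 0 < delta x) -> continuous delta ->
  exists b' : X -> 'cV[R[i]]_(2 + m),
    [/\ continuous b', forall x, usubmx (b' x) != 0
      & forall x, \tr ((b' x - b x) *m (b' x - b x)^t*) < (delta x ^+ 2)%:C].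
Proof.
move=> nX dX cb d0 cd.
(* The quotient of [i] by 2 selects one of the two leading entries, its parity the real or imaginary
   part. *)
pose h (i : 'I_4) x : R := let z := b x (lshift m (inord i./2)) 0 in
  if odd i then complex.Im z else complex.Re z.
have cbij i j : continuous (fun x => b x i j) by move/continuous_mxP : cb.
have ch i : continuous (h i).
  rewrite /h; have /continuous_complexP[cRe cIm] := cbij (lshift m (inord i./2)) 0.
  by case: (odd i).
(* Four real coordinates, each moved by less than [delta / 2], give a squared error below
   [delta ^+ 2]. *)
have d20 x : 0 < delta x / 2 by rewrite divr_gt0.
have cd2 : continuous (fun x => delta x / 2).
  by move=> x; apply: cvgM; [exact: cd|exact: cvg_cst].
have [h' [ch' h'_near h'0]] := nonvanishing_approximation _ _ _ h _ nX dX ch d20 cd2.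
pose a x : 'cV[R[i]]_2 :=
  \col_j ((h' (inord j.*2) x) +i* (h' (inord j.*2.+1) x)).
exists (fun x => col_mx (a x) (dsubmx (b x))); split.
- apply/continuous_mxP => i j.
  case: (split_ordP i) => i' ->.
    under eq_fun do rewrite col_mxEu mxE.
    by apply/continuous_complexP; split; exact: ch'.
  by under eq_fun do rewrite col_mxEd mxE; exact: cbij.
- move=> x; rewrite col_mxKu; have [i ] := h'0 x.
  apply: contra => /eqP/colP/(_ (inord i./2)); rewrite !mxE.
  have i2 : (i./2 < 2)%N by rewrite ltn_half_double.
  rewrite inordK// => -[hRe hIm].
  have iE : i = inord (odd i + i./2.*2) by rewrite odd_double_half inord_val.
  by rewrite iE; case: (odd i); rewrite ?add1n ?add0n ?hRe ?hIm.
- move=> x.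
  have -> : col_mx (a x) (dsubmx (b x)) - b x = col_mx (a x - usubmx (b x)) 0.
    by rewrite -{2}[b x]vsubmxK opp_col_mx add_col_mx subrr.
  rewrite tr_col_mx map_row_mx mul_col_row mxtrace_block mul0mx mxtrace0 addr0.
  have dj (j : 'I_2) : ((a x - usubmx (b x)) *m (a x - usubmx (b x))^t*) j j
      < (delta x ^+ 2 / 2)%:C.
    rewrite mxE big_ord1 !mxE -normCK -add_Re2_Im2 ltcR raddfB/= raddfB/=.
    have := h'_near (inord j.*2) x; have := h'_near (inord j.*2.+1) x.
    have j4 : (j.*2.+1 < 4)%N by rewrite -doubleS (leq_double _ 2).
    rewrite /h !inordK ?(ltnW j4)//= odd_double/= uphalf_double half_double inord_val.
    have sq (y e : R) : `|y| < e -> y ^+ 2 < e ^+ 2.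
      by move=> ye; rewrite -real_normK ?num_real// ltr_pXn2r ?nnegrE// ltW// (le_lt_trans _ ye).
    move=> /sq h1 /sq h2.
    have -> : delta x ^+ 2 / 2 = (delta x / 2) ^+ 2 + (delta x / 2) ^+ 2 by field.
    exact: ltrD.
  rewrite /mxtrace big_ord_recl big_ord1.
  have -> : (delta x ^+ 2)%:C = (delta x ^+ 2 / 2)%:C + (delta x ^+ 2 / 2)%:C.
    by rewrite -rmorphD/=; congr (_%:C); field.
  exact: ltrD.
Qed.

Lemma unitary_adjK (C : numClosedFieldType) (n : nat) (w : 'M[C]_n) :
  w \is unitarymx -> w^t* *m w = 1%:M.
Proof. by rewrite -trmxC_unitary => /unitarymxP; rewrite trmxCK. Qed.

Lemma trace_unitary_conj (C : numClosedFieldType) (n : nat) (w p : 'M[C]_n) :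
  w \is unitarymx ->
  \tr ((w *m p *m w^t*) *m (w *m p *m w^t*)^t*) = \tr (p *m p^t*).
Proof.
move=> /unitary_adjK ww; rewrite !adjmx_mul trmxCK !mulmxA.
rewrite -[w *m p *m _ *m w]mulmxA ww mulmx1.
by rewrite mxtrace_mulC !mulmxA ww mul1mx.
Qed.

Lemma hermsymmx_conj (C : numClosedFieldType) (m n : nat) (w : 'M[C]_(m, n)) (A : 'M[C]_n) :
  A \is hermsymmx -> w *m A *m w^t* \is hermsymmx.
Proof.
by move=> /hermsymmxP hA; apply/hermsymmxP; rewrite !adjmx_mul trmxCK hA mulmxA.
Qed.

Lemma hermitian_block (C : numClosedFieldType) (m n : nat) (A : 'M[C]_(m + n)) :
  A \is hermsymmx ->
  [/\ ulsubmx A \is hermsymmx, drsubmx A \is hermsymmx &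
      A = block_mx (ulsubmx A) ((dlsubmx A)^t*) (dlsubmx A) (drsubmx A)].
Proof.
move=> /hermsymmxP hA.
have : (block_mx (ulsubmx A) (ursubmx A) (dlsubmx A) (drsubmx A))^t* =
    block_mx (ulsubmx A) (ursubmx A) (dlsubmx A) (drsubmx A) by rewrite submxK.
rewrite tr_block_mx map_block_mx => /eq_block_mx[hul hur _ hdr].
by split; [exact/hermsymmxP|exact/hermsymmxP|rewrite hur submxK].
Qed.

Lemma block_hermitian (C : numClosedFieldType) (m n : nat) (A : 'M[C]_m)
    (b : 'M[C]_(n, m)) (D : 'M[C]_n) :
  A \is hermsymmx -> D \is hermsymmx -> block_mx A (b^t*) b D \is hermsymmx.
Proof.
move=> /hermsymmxP hA /hermsymmxP hD; apply/hermsymmxP.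
by rewrite tr_block_mx map_block_mx hA hD trmxCK.
Qed.

(* That w fixes the first basis vector lets the induction extend w by a
   block 1 without disturbing the column already reduced. *)
Definition hessenberg_approximable (R : realType) (X : topologicalType) (n : nat)
    (f : X -> 'M[R[i]]_n) (delta : X -> R) :=
  exists f' w : X -> 'M[R[i]]_n,
    [/\ continuous f', forall x, f' x \is hermsymmx, continuous w
      & forall x, w x \is unitarymx] /\
    [/\ forall x, \tr ((f' x - f x) *m (f' x - f x)^t*) < (delta x ^+ 2)%:C,
        forall x (i j : 'I_n), j = 0%N :> nat -> w x i j = (i == j)%:R,
        forall x (i j : 'I_n), (j.+1 < i)%N -> (w x *m f' x *m (w x)^t*) i j = 0
      & forall x (i j : 'I_n), i = j.+1 :> nat -> (i.+1 < n)%N ->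
          (w x *m f' x *m (w x)^t*) i j != 0].

Lemma hessenberg_approximable_step (R : realType) (X : topologicalType) (m : nat)
    (f : X -> 'M[R[i]]_(1 + (2 + m))) (delta : X -> R) :
  normal_space X -> covering_dim_le 3 X ->
  (forall f1 : X -> 'M[R[i]]_(2 + m), continuous f1 ->
    (forall x, f1 x \is hermsymmx) ->
    hessenberg_approximable R X _ f1 (fun x => delta x / 2)) ->
  continuous f -> (forall x, f x \is hermsymmx) ->
  (forall x, 0 < delta x) -> continuous delta ->
  hessenberg_approximable R X _ f delta.
Proof.
move=> nX dX IH cf hf d0 cd.
pose c x := ulsubmx (f x); pose b x := dlsubmx (f x); pose f0 x := drsubmx (f x).
have hc x : c x \is hermsymmx by have [] := hermitian_block _ _ _ _ (hf x).
have hf0 x : f0 x \is hermsymmx by have [] := hermitian_block _ _ _ _ (hf x).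
have fE x : f x = block_mx (c x) ((b x)^t*) (b x) (f0 x).
  by have [] := hermitian_block _ _ _ _ (hf x).
have cfij i j : continuous (fun x => f x i j) by move/continuous_mxP : cf.
have cc : continuous c.
  by apply/continuous_mxP => i j; under eq_fun do rewrite !mxE; exact: cfij.
have cb : continuous b.
  by apply/continuous_mxP => i j; under eq_fun do rewrite !mxE; exact: cfij.
have cf0 : continuous f0.
  by apply/continuous_mxP => i j; under eq_fun do rewrite !mxE; exact: cfij.
have d20 x : 0 < delta x / 2 by rewrite divr_gt0.
have cd2 : continuous (fun x => delta x / 2).
  by move=> x; apply: cvgM; [exact: cd|exact: cvg_cst].
have [b' [cb' b'0 b'_near]] := column_approximation _ _ _ b _ nX dX cb d20 cd2.
have [w1 [r [cw1 uw1 r0 w1b]]] := unitary_rotation _ _ _ b' cb' b'0.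
pose f1 x := w1 x *m f0 x *m (w1 x)^t*.
have cw1' : continuous (fun x => (w1 x)^t*) by exact: continuous_adjmx.
have cf1 : continuous f1.
  apply: continuous_mulmx; last exact: cw1'.
  by apply: continuous_mulmx; [exact: cw1|exact: cf0].
have hf1 x : f1 x \is hermsymmx by exact: hermsymmx_conj.
have [f1' [w' [[cf1' hf1' cw' uw'] [f1'f1 w'0 g0 gn0]]]] := IH f1 cf1 hf1.
pose V x := w' x *m w1 x.
(* The approximation of the rotated block is rotated back, so that conjugation by [V] turns it into
   the Hessenberg matrix of the induction hypothesis. *)
pose f0' x := (w1 x)^t* *m f1' x *m w1 x.
pose f' x := block_mx (c x) ((b' x)^t*) (b' x) (f0' x).
pose w x : 'M[R[i]]_(1 + (2 + m)) := block_mx 1%:M 0 0 (V x).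
have uV x : V x \is unitarymx by exact: mul_unitarymx.
have w'e x : w' x *m delta_mx 0 0 = delta_mx 0 0 :> 'cV_(2 + m).
  apply/colP => i; rewrite mxE (bigD1 0)//= big1 ?addr0 => [|j /negPf j0].
    by rewrite w'0// !mxE !eqxx mulr1 andbT.
  by rewrite !mxE j0 mulr0.
have Vb x : V x *m b' x = r x *: delta_mx 0 0.
  by rewrite /V -mulmxA w1b -scalemxAr w'e.
have wfw x : w x *m f' x *m (w x)^t* =
    block_mx (c x) ((r x *: delta_mx 0 0)^t*) (r x *: delta_mx 0 0)
      (w' x *m f1' x *m (w' x)^t*).
  rewrite /w /f' tr_block_mx map_block_mx !trmx0 !map_mx0 trmx1 map_mx1.
  rewrite !mulmx_block !mul0mx !mulmx0 !mul1mx !mulmx1 !addr0 !add0r.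
  rewrite Vb -adjmx_mul Vb /f0' /V adjmx_mul; congr block_mx.
  have /unitarymxP w1w := uw1 x.
  rewrite !mulmxA -(mulmxA (w' x)) w1w mulmx1.
  by rewrite -(mulmxA (w' x *m f1' x)) w1w mulmx1.
exists f', w; split; split.
- apply: continuous_block_mx; [exact: cc| |exact: cb'|].
    by apply: continuous_adjmx; exact: cb'.
  apply: continuous_mulmx; last exact: cw1.
  by apply: continuous_mulmx; [exact: cw1'|exact: cf1'].
- move=> x; apply: block_hermitian; first exact: hc.
  by rewrite /f0' -{2}[w1 x]trmxCK; exact: hermsymmx_conj.
- apply: continuous_block_mx; [exact: cst_continuous..|].
  by apply: continuous_mulmx; [exact: cw'|exact: cw1].
- move=> x; apply: block_diag_unitary; last exact: uV.
  by apply/unitarymxP; rewrite mul1mx trmx1 map_mx1.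
- move=> x; pose d := b' x - b x; pose p := f0' x - f0 x.
  have -> : f' x - f x = block_mx 0 (d^t*) d p.
    rewrite fE /f' opp_block_mx add_block_mx subrr; congr block_mx.
    by rewrite /d linearB/= map_mxB.
  rewrite tr_block_mx map_block_mx trmx0 map_mx0 trmxCK mulmx_block.
  rewrite mxtrace_block mul0mx add0r [X in X + _]mxtrace_mulC.
  rewrite [\tr (_ + _)]raddfD/=.
  have -> : \tr (p *m p^t*) =
      \tr ((f1' x - f1 x) *m (f1' x - f1 x)^t*).
    rewrite -(trace_unitary_conj _ _ (w1 x) p (uw1 x)); congr (\tr (_ *m _^t*));
    rewrite /p /f1 mulmxBr mulmxBl /f0'; congr (_ - _);
    have /unitarymxP w1w := uw1 x; rewrite !mulmxA w1w mul1mx;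
    by rewrite -mulmxA w1w mulmx1.
  (* Of the four shares, the column error [d] uses two, since it also occurs in the adjoint row, and
     [p] uses one; the last is slack. *)
  have -> : (delta x ^+ 2)%:C = ((delta x / 2) ^+ 2)%:C +
      (((delta x / 2) ^+ 2)%:C + ((delta x / 2) ^+ 2)%:C + ((delta x / 2) ^+ 2)%:C).
    by rewrite -!rmorphD/=; congr (_%:C); field.
  apply: ltrD; first exact: b'_near.
  apply: ltrD => //; apply: lt_trans (b'_near x) _.
  by rewrite ltrDl ltcR exprn_gt0.
- move=> x i j j0.
  have -> : j = lshift (2 + m) 0 by apply: val_inj.
  case: (split_ordP i) => i' ->.
    by rewrite block_mxEul mxE (inj_eq (@lshift_inj _ _)).
  by rewrite block_mxEdl mxE; case: eqP => // /(congr1 val).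
- move=> x i j; rewrite wfw.
  case: (split_ordP i) => i' ->; first by rewrite (ord1 i').
  case: (split_ordP j) => j' ->.
    rewrite block_mxEdl !mxE (ord1 j')/= => i1.
    by case: eqP => [i0|]; [move: i1; rewrite i0|rewrite mulr0].
  by rewrite block_mxEdr/= => ij; apply: g0; move: ij; rewrite !add1n ltnS.
- move=> x i j; rewrite wfw.
  case: (split_ordP i) => i' ->; first by rewrite (ord1 i').
  case: (split_ordP j) => j' ->.
    rewrite block_mxEdl !mxE (ord1 j')/= => i1 _.
    rewrite (_ : i' = 0) ?eqxx ?mulr1//; apply: val_inj.
    by move: i1; rewrite add1n => -[].
  rewrite block_mxEdr/= !add1n => -[ij] i2.
  exact: gn0.
Qed.

Lemma hessenberg_approximation (R : realType) (X : topologicalType) (n : nat)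
    (f : X -> 'M[R[i]]_n) (delta : X -> R) :
  normal_space X -> covering_dim_le 3 X ->
  continuous f -> (forall x, f x \is hermsymmx) ->
  (forall x, 0 < delta x) -> continuous delta ->
  hessenberg_approximable R X n f delta.
Proof.
move=> nX dX; elim/ltn_ind: n f delta => n IH f delta cf hf d0 cd.
(* No entry lies below the subdiagonal, and [i.+1 < n] exempts the only subdiagonal entry. That
   entry is one complex function, whose zeros a dimension bound of 3 does not allow to be removed in
   general. *)
have base : (n <= 2)%N -> hessenberg_approximable R X n f delta.
  move=> n2; exists f, (fun=> 1%:M); split; split.
  - exact: cf.
  - exact: hf.
  - exact: cst_continuous.
  - by move=> x; apply/unitarymxP; rewrite mul1mx trmx1 map_mx1.
  - by move=> x; rewrite subrr mul0mx mxtrace0 ltcR exprn_gt0.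
  - by move=> x i j _; rewrite mxE.
  - by move=> x i j ji; have := leq_trans (leq_ltn_trans ji (ltn_ord i)) n2.
  - by move=> x i j -> jn; have := leq_trans jn n2.
case: n f IH cf hf base => [|[|[|m]]] f IH cf hf base; [exact: base..|].
apply: (hessenberg_approximable_step R X m f _ nX dX _ cf hf d0 cd) => f1 cf1 hf1.
apply: (IH m.+2 _ f1 _ cf1 hf1) => [//|x|x]; first by rewrite divr_gt0.
by apply: cvgM; [exact: cd|exact: cvg_cst].
Qed.

(* The matrix size n >= 1 is written k + 1. *)
Theorem corollary4p3 (R : realType) (k : nat) (X : topologicalType)
    (f : X -> 'M[R[i]]_(k + 1)) (eps : X -> R) :
  normal_space X ->
  covering_dim_le 3 X ->
  (forall x, f x \is hermsymmx) ->
  continuous f ->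
  (forall x, 0 < eps x) ->
  continuous eps ->
  exists (g u : X -> 'M[R[i]]_(k + 1)) (U : set X),
    [/\ (forall x, g x \is hermsymmx) /\ continuous g,
        (forall x, u x \is unitarymx) /\ continuous u,
        forall x, opnorm (u x *m f x *m (u x)^t* - g x) < eps x
      & [/\ open U,
            forall x, U x -> has_distinct_eigenvalues (g x)
          & forall x, ~ U x ->
              exists (g' : 'M[R[i]]_k) (lambda : R),
                g x = block_mx g' 0 0 (lambda%:C%:M) /\
                has_distinct_eigenvalues g']].
Proof.
move=> nX dX hf cf eps0 ceps.
have [f' [u [[cf' hf' cu uu] [f'f _ g0 gn0]]]] :=
  hessenberg_approximation R X _ f eps nX dX cf hf eps0 ceps.
pose g x := u x *m f' x *m (u x)^t*.
have cg : continuous g.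
  by apply: continuous_mulmx; [exact: continuous_mulmx|exact: continuous_adjmx].
have hg x : g x \is hermsymmx by exact: hermsymmx_conj.
(* By [gn0] only the last subdiagonal entry is in question; for [k = 0] there is none and [U] is all
   of [X]. *)
pose U := [set x | forall i j : 'I_(k + 1), i = j.+1 :> nat -> g x i j != 0].
exists g, u, U; split; [by split|by split| |split].
- move=> x; apply: opnorm_lt_frobenius => //.
  have -> : u x *m f x *m (u x)^t* - g x = - (u x *m (f' x - f x) *m (u x)^t*).
    by rewrite mulmxBr mulmxBl opprB.
  rewrite linearN/= map_mxN mulNmx mulmxN opprK trace_unitary_conj//; exact: f'f.
- rewrite openE => x Ux.
  suff : nbhs x [set y | forall ij : 'I_(k + 1) * 'I_(k + 1),
      ij.1 = ij.2.+1 :> nat -> g y ij.1 ij.2 != 0].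
    by apply: filterS => y Uy i j; exact: (Uy (i, j)).
  apply: filter_forall => -[i j] /=.
  have [ij|ij] := pselect (i = j.+1 :> nat); last first.
    by apply: filterS filterT => y _ /ij.
  have /continuous_mxP/(_ i j x) cgij := cg.
  by apply: filterS (cvgr_neq0 _ cgij (Ux i j ij)) => y.
- by move=> x Ux; apply: hessenberg_distinct_eigenvalues => //; exact: g0.
- move=> x nUx.
  have [hul hdr gE] := hermitian_block _ _ _ _ (hg x).
  have last_subdiag (i j : 'I_(k + 1)) :
      i = j.+1 :> nat -> i = k :> nat -> g x i j = 0.
    move=> ij ik; apply: contrapT => /eqP gij; apply: nUx => i' j' ij'.
    have [|i'k] := ltnP i'.+1 (k + 1)%N; first exact: gn0.
    have i'E : i' = i.
      apply/val_inj/anti_leq; rewrite /= ik.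
      have := ltn_ord i'; rewrite [X in (_ < X)%N]addn1 ltnS => -> /=.
      by move: i'k; rewrite [X in (X <= _)%N]addn1 ltnS.
    have -> : j' = j by apply/val_inj/succn_inj; rewrite -ij -ij' i'E.
    by rewrite i'E.
  (* In the last row, the entry next to the diagonal vanishes off [U], and those before it vanish by
     the Hessenberg shape. *)
  have dl0 : dlsubmx (g x) = 0.
    apply/matrixP => i j; rewrite [RHS]mxE.
    have -> : dlsubmx (g x) i j = g x (rshift k i) (lshift 1 j) by rewrite !mxE.
    have [jk|kj] := ltnP j.+1 k.
      by apply: g0; rewrite (ord1 i)/= addn0.
    apply: last_subdiag; rewrite (ord1 i)/= addn0//.
    by apply/eqP; rewrite eqn_leq kj ltn_ord.
  exists (ulsubmx (g x)), (complex.Re (drsubmx (g x) 0 0)); split.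
    rewrite {1}gE dl0 trmx0 map_mx0; congr block_mx.
    rewrite [LHS]mx11_scalar RRe_real//; apply/CrealP.
    by move/hermsymmxP : hdr => /matrixP/(_ 0 0); rewrite mxE mxE.
  (* Every subdiagonal entry of the upper left block has row index below [k], hence is nonzero by
     [gn0]. *)
  apply: hessenberg_distinct_eigenvalues => // i j ij.
    have -> : ulsubmx (g x) i j = g x (lshift 1 i) (lshift 1 j) by rewrite !mxE.
    exact: g0.
  have -> : ulsubmx (g x) i j = g x (lshift 1 i) (lshift 1 j) by rewrite !mxE.
  by apply: gn0 => //=; rewrite addn1 ltnS.
Qed.
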